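(* Let $G$ be a finite group. If $G$ is non-solvable, then $\eta(G)\ge 4$. Consequently, $\eta(G)\le 3$ implies that $G$ is solvable.
   Context: For a finite group $G$, $\omega(G)$ denotes the set of orders of elements of $G$ and $\eta(G)=|\omega(G)|$. *)

(* Defs.v *)
From mathcomp Require Import all_boot all_fingroup all_solvable finmap.

Set Implicit Arguments.
Unset Strict Implicit.
Unset Printing Implicit Defensive.

Import GroupScope.

Definition omega (gT : finGroupType) (G : {group gT}) : {fset nat} :=
  [fset #[x] | x in G]%fset.

Definition eta (gT : finGroupType) (G : {group gT}) : nat := #|` omega G|%fset.

(* Main.v *)
Require Import Defs.
From mathcomp Require Import all_boot all_fingroup all_solvable finmap.
From mathcomp Require Import integral_char.

(** Burnside's p^a q^b theorem says that a group whose order has at most two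
    prime divisors is solvable, so a non-solvable G has at least three.  By
    Cauchy's theorem each of these primes is the order of an element of G, and
    the identity contributes the order 1, which is not prime.  Hence G has at
    least four element orders. *)

(** The orders that are forced to occur in any group are 1, from the identity,
    and, by Cauchy's theorem, each prime divisor of #|G|; they are pairwise
    distinct since 1 is not prime. *)
Lemma primes_lt_eta (gT : finGroupType) (G : {group gT}) :
  size (primes #|G|) < eta G.
Proof.
have uniq_1p : uniq (1 :: primes #|G|).
  by rewrite /= primes_uniq mem_primes.
rewrite /eta -[(size _).+1]/(size (1 :: primes #|G|)).
apply: uniq_leq_size => // n; rewrite inE => /predU1P[-> | ].
  by apply/imfsetP; exists 1%g; rewrite ?order1 //= group1.
rewrite mem_primes => /and3P[p_pr _ pG].
have [x Gx ox] := Cauchy p_pr pG.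
by apply/imfsetP; exists x; rewrite ?ox.
Qed.

Theorem theorem5p3 (gT : finGroupType) (G : {group gT}) :
  (~~ solvable G -> 4 <= eta G) /\ (eta G <= 3 -> solvable G).
Proof.
have nonsol : ~~ solvable G -> 4 <= eta G.
  move=> nsolG; apply: leq_trans (primes_lt_eta _ G).
  by rewrite ltnS ltnNge; apply: contra nsolG => /Burnside_p_a_q_b.
split=> // eta3; apply/negPn/negP => /nonsol.
by rewrite ltnNge eta3.
Qed.
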